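(* Let $\mathcal{H}$ be a real Hilbert space, let $M\colon\mathcal{H}\to 2^{\mathcal{H}}$ be a maximally monotone operator such that $Z=\mathrm{zer}\,M\neq\varnothing$, let $x_0\in\mathcal{H}$, let $(\lambda_n)_{n\in\mathbb{N}}$ be a sequence in $]0,1]$ such that $\inf_{n\in\mathbb{N}}\lambda_n>0$, and let $(\gamma_n)_{n\in\mathbb{N}}$ be a sequence in $]0,+\infty[$ such that $\inf_{n\in\mathbb{N}}\gamma_n>0$. Iterate $$(\forall n\in\mathbb{N})\quad x_{n+1}=\mathsf{Q}\bigl(x_0,x_n,x_n+\lambda_n(J_{\gamma_nM}x_n-x_n)\bigr).$$ Then $(x_n)_{n\in\mathbb{N}}$ converges strongly to $\mathrm{proj}_Zx_0$.
   Context: For $M\colon\mathcal{H}\to2^{\mathcal{H}}$, $\mathrm{zer}\,M=\{x\mid 0\in Mx\}$ and $J_M=(\mathrm{Id}+M)^{-1}$ is the resolvent (single-valued and defined everywhere when $M$ is maximally monotone). $M$ is maximally monotone if it is monotone and no monotone operator has a graph strictly containing that of $M$. $\mathrm{proj}_D$ is the projection operator onto a nonempty closed convex set $D$. For $(x,y)\in\mathcal{H}^2$, $H(x,y)=\{z\in\mathcal{H}\mid\langle z-y\mid x-y\rangle\leq 0\}$; for $(x,y,z)\in\mathcal{H}^3$ such that $H(x,y)\cap H(y,z)\neq\varnothing$, $\mathsf{Q}(x,y,z)$ is the projection of $x$ onto $H(x,y)\cap H(y,z)$. *)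

(* Defs.v *)
From HB Require Import structures.
From mathcomp Require Import all_boot all_order all_algebra.
From mathcomp Require Import all_classical all_reals all_analysis.
Import Order.TTheory GRing.Theory Num.Theory.
Import numFieldNormedType.Exports.

Set Implicit Arguments.
Unset Strict Implicit.
Unset Printing Implicit Defensive.

Local Open Scope classical_set_scope.
Local Open Scope ring_scope.

(* A real Hilbert space is a complete normed module over a realType together
   with a positive definite symmetric bilinear form inducing its norm. *)
Definition induces_norm (R : realType) (H : normedModType R)
    (dot : {dot H for idfun}) : Prop :=
  forall x : H, `|x| = Num.sqrt (dot x x).

(* A set-valued operator H -> 2^H is a function H -> set H. *)

Definition graph_op (H : Type) (M : H -> set H) : set (H * H) :=
  [set p | M p.1 p.2].

Definition inv_op (H : Type) (M : H -> set H) : H -> set H :=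
  fun u => [set x | M x u].

Definition scale_op (R : realType) (H : lmodType R) (c : R) (M : H -> set H) :
    H -> set H :=
  fun x => [set c *: u | u in M x].

Definition id_plus_op (H : zmodType) (M : H -> set H) : H -> set H :=
  fun x => [set x + u | u in M x].

Definition zer (H : zmodType) (M : H -> set H) : set H := [set x | M x 0].

Definition monotone_op (R : realType) (H : lmodType R)
    (dot : {dot H for idfun}) (M : H -> set H) : Prop :=
  forall x y u v : H, M x u -> M y v -> 0 <= dot (x - y) (u - v).

Definition maximally_monotone (R : realType) (H : lmodType R)
    (dot : {dot H for idfun}) (M : H -> set H) : Prop :=
  monotone_op dot M /\
  ~ exists N : H -> set H, monotone_op dot N /\ graph_op M `<` graph_op N.

(* The single value of (Id + M)^-1 at x.  [xget 0] selects an element of that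
   set, with the default value 0 only when it is empty; for a maximally
   monotone M on a Hilbert space the set is always a singleton. *)
Definition resolvent (H : zmodType) (M : H -> set H) (x : H) : H :=
  xget 0 (inv_op (id_plus_op M) x).

(* The nearest point to x in D, with the default value 0 only when there is
   none; it exists and is unique for D nonempty, closed and convex in a
   Hilbert space. *)
Definition proj_onto (R : realType) (H : normedModType R) (D : set H) (x : H) : H :=
  xget 0 [set p | D p /\ forall y : H, D y -> `|x - p| <= `|x - y|].

Definition halfspace (R : realType) (H : lmodType R)
    (dot : {dot H for idfun}) (x y : H) : set H :=
  [set z | dot (z - y) (x - y) <= 0].

(* Meaningful when the intersection is nonempty. *)
Definition haugazeau_Q (R : realType) (H : normedModType R)
    (dot : {dot H for idfun}) (x y z : H) : H :=
  proj_onto (halfspace dot x y `&` halfspace dot y z) x.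

(* Main.v *)
(* Everything rests on one substitute for weak compactness: along a nested
   sequence of convex sets, points almost minimizing a uniformly convex function
   form a Cauchy sequence. It yields projections onto closed convex sets, and
   Minty's theorem as the minimization of the Fitzpatrick function of M plus
   half the squared norm, so that the resolvents exist.
   The halfspaces H(x_0, x_n) and H(x_n, y_n), where
   y_n = x_n + lambda_n (J x_n - x_n), contain Z, so |x_n - x_0| increases to a
   limit l <= dist(x_0, Z) and |J x_n - x_n| tends to 0. Since
   (x_n - J x_n) / gamma_n lies in M (J x_n), each (a, b) in M gives
   <a - x_n, b> >= - epsilon_n, a constraint affine in x_n. Relaxing these
   constraints by epsilon gives convex sets decreasing to Z and containing the
   tail of (x_n), whence a point of Z at distance at most l from x_0. Thus
   l = |x_0 - p| with p = proj_Z x_0, and p in H(x_0, x_n) gives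
   |p - x_n|^2 <= |p - x_0|^2 - |x_n - x_0|^2, which tends to 0. *)
Require Import Defs.
From HB Require Import structures.
From mathcomp Require Import all_boot all_order all_algebra.
From mathcomp Require Import all_classical all_reals all_analysis.
From mathcomp Require Import ring lra.
Import Order.TTheory GRing.Theory Num.Theory.
Import numFieldNormedType.Exports.

Local Open Scope classical_set_scope.
Local Open Scope ring_scope.

(** * Near-minimizers over nested sets, with two tools on sequences and reals *)

(** The infima [m k] increase to a limit at most [L]. Late near-minimizers lie in a common set whose
    infimum is close to that limit; [f r] cannot drop below this infimum, so [d] is small. [d] is
    arbitrary because [minty0] uses one that ignores a coordinate. *)
Lemma nested_minimizing_sequence (R : realType) (T : Type) (f : T -> R)
    (d : T -> T -> R) (A : nat -> set T) (l L : R) :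
  (forall i j, (i <= j)%N -> A j `<=` A i) ->
  (forall k p, A k p -> l <= f p) ->
  (forall k e, 0 < e -> exists2 p, A k p & f p <= L + e) ->
  (forall k p q, A k p -> A k q ->
    exists2 r, A k r & d p q <= (f p + f q) / 2 - f r) ->
  exists u : nat -> T,
    [/\ forall k, A k (u k),
        forall e, 0 < e -> exists N, forall k, (N <= k)%N -> f (u k) <= L + e &
        forall e, 0 < e -> exists N, forall i j, (N <= i)%N -> (N <= j)%N ->
          d (u i) (u j) <= e].
Proof.
move=> Adec flb Lapprox mid.
pose m k := inf [set f p | p in A k].
have hinf k : has_inf [set f p | p in A k].
  split; first by have [p Ap _] := Lapprox k 1 ltr01; exists (f p), p.
  by exists l => _ [p Ap <-]; exact: flb Ap.
have m_le k p : A k p -> m k <= f p.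
  by move=> Ap; apply: (ge_inf (proj2 (hinf k))); exists p.
have mL k : m k <= L.
  apply/ler_addgt0Pr => e e0; have [p Ap fp] := Lapprox k e e0.
  exact: le_trans (m_le _ _ Ap) fp.
have pick k : {p | A k p & f p < m k + k.+1%:R^-1}.
  apply: cid2; have k0 : 0 < k.+1%:R^-1 :> R by rewrite invr_gt0 ltr0n.
  by have [_ [p Ap <-] lt] := inf_adherent k0 (hinf k); exists p.
pose u k := s2val (pick k).
have uA k : A k (u k) by rewrite /u; case: (pick k).
have um k : f (u k) < m k + k.+1%:R^-1 by rewrite /u; case: (pick k).
have small e : 0 < e -> exists N, forall k, (N <= k)%N -> k.+1%:R^-1 <= e :> R.
  move=> e0; have [N] := ltr_add_invr e0; rewrite add0r => lt.
  exists N => k Nk; apply: le_trans (ltW lt).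
  by rewrite lef_pV2 ?posrE ?ltr0n // ler_nat ltnS.
exists u; split=> // e e0.
  have [N NP] := small e e0; exists N => k /NP ke.
  by apply: le_trans (ltW (um k)) _; rewrite lerD.
have hsup : has_sup (range m).
  by split; [exists (m 0%N), 0%N|exists L => _ [k _ <-]].
have e20 : 0 < e / 2 by rewrite divr_gt0.
have [_ [N1 _ <-] mN1] := sup_adherent e20 hsup.
have [N2 NP] := small _ e20.
pose N := maxn N1 N2; exists N => i j Ni Nj.
have inN k : (N <= k)%N -> A N1 (u k) /\ f (u k) <= sup (range m) + e / 2.
  rewrite geq_max => /andP[N1k N2k]; split; first exact: Adec N1k _ (uA k).
  apply: le_trans (ltW (um k)) _; apply: lerD; last exact: NP.
  by apply: sup_upper_bound => //; exists k.
have [Ai fi] := inN i Ni; have [Aj fj] := inN j Nj.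
have [r /m_le mr dr] := mid _ _ _ Ai Aj; lra.
Qed.

Lemma cvgn_sqr_cauchy (R : realType) (E : completeNormedModType R)
    (u : nat -> E) :
  (forall e, 0 < e -> exists N, forall i j, (N <= i)%N -> (N <= j)%N ->
    `|u i - u j| ^+ 2 <= e) ->
  cvgn u.
Proof.
move=> hu; apply: cauchy_cvg; apply: cauchy_exP => e e0.
have e20 : 0 < (e / 2) ^+ 2 by rewrite exprn_gt0 // divr_gt0.
have [N hN] := hu _ e20; exists (u N); exists N => // k /= Nk.
have := hN N k (leqnn _) Nk.
rewrite ler_sqr ?nnegrE ?divr_ge0 ?(ltW e0) // => le.
by rewrite -ball_normE /ball_ /=; apply: le_lt_trans le _; lra.
Qed.

(** First-order optimality: for small [s] the linear term dominates. *)
Lemma lin_coef_ge0 (R : realType) (a b : R) :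
  (forall s, 0 < s <= 1 -> 0 <= s * a + s ^+ 2 * b) -> 0 <= a.
Proof.
move=> h; rewrite leNgt; apply/negP => a0.
(* For this [s], a + s|b| = s(a - 1), which is negative. *)
have := h (- a / (- a + `|b| + 1)); have := normr_ge0 b => b0.
have D0 : 0 < - a + `|b| + 1 by lra.
rewrite divr_gt0 ?oppr_gt0 //= ler_pdivrMr // => /(_ ltac:(lra)).
set s := _ / _ => hs.
have s0 : 0 < s by rewrite divr_gt0 ?oppr_gt0.
have sD : s * (- a + `|b| + 1) = - a by rewrite divfK // gt_eqF.
have bb := ler_norm b.
have : 0 <= a + s * b by rewrite -(pmulr_rge0 _ s0) mulrDr mulrA -expr2.
have : s * b <= s * `|b| by rewrite ler_pM2l.
nra.
Qed.

Section Hilbert.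
Context {R : realType} {H : completeNormedModType R}.
Context {dot : {dot H for idfun}} (hdot : induces_norm dot).
Implicit Types (x y z a b u v : H) (M : H -> set H).

(** * Inner product: algebra, Cauchy-Schwarz and continuity *)

Lemma dotC x y : dot x y = dot y x.
Proof. by rewrite hermC /= mul1r. Qed.

Lemma dotZl (c : R) x z : dot (c *: x) z = c * dot x z.
Proof. by rewrite linearZl_LR. Qed.

Lemma dotZr (c : R) x z : dot x (c *: z) = c * dot x z.
Proof. by rewrite linearZr_LR. Qed.

Lemma dotBl x y z : dot (x - y) z = dot x z - dot y z.
Proof. exact: linearBl. Qed.

Lemma dotBr x y z : dot x (y - z) = dot x y - dot x z.
Proof. exact: linearBr. Qed.

Lemma dotDl x y z : dot (x + y) z = dot x z + dot y z.
Proof. exact: linearDl. Qed.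

Lemma dotDr x y z : dot x (y + z) = dot x y + dot x z.
Proof. exact: linearDr. Qed.

Lemma dotNl x y : dot (- x) y = - dot x y.
Proof. exact: linearNl. Qed.

Lemma dotNr x y : dot x (- y) = - dot x y.
Proof. exact: linearNr. Qed.

Lemma dot0l x : dot 0 x = 0.
Proof. exact: linear0l. Qed.

Lemma dot0r x : dot x 0 = 0.
Proof. exact: linear0r. Qed.

Definition dotE := (dotBl, dotBr, dotDl, dotDr, dotZl, dotZr, dotNl, dotNr,
  dot0l, dot0r).

Lemma dotxx x : dot x x = `|x| ^+ 2.
Proof.
rewrite hdot sqr_sqrtr //; have [->|/(neq0_dnorm_gt0 (s := dot))/ltW//] := eqVneq x 0.
by rewrite linear0l.
Qed.

Lemma dotxx_ge0 x : 0 <= dot x x.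
Proof. by rewrite dotxx sqr_ge0. Qed.

Lemma cauchy_schwarz x y : `|dot x y| <= `|x| * `|y|.
Proof.
rewrite -ler_sqr ?nnegrE ?mulr_ge0 // exprMn real_normK ?num_real // -!dotxx.
have [->|y0] := eqVneq y 0; first by rewrite !dotE expr0n mulr0.
have yy : 0 < dot y y by exact: neq0_dnorm_gt0.
have := dotxx_ge0 (dot y y *: x - dot x y *: y).
rewrite !dotE (dotC y x) => h.
rewrite -subr_ge0 -(pmulr_rge0 _ yy); apply: le_trans h _; lra.
Qed.

Lemma dot_continuous a : continuous (dot^~ a).
Proof.
move=> x; apply/cvgrPdist_le => e e0.
have a0 : 0 < `|a| + 1 by rewrite ltr_wpDl.
near=> y; rewrite -linearBl; apply: le_trans (cauchy_schwarz _ _) _.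
have xy : `|x - y| <= e / (`|a| + 1).
  near: y; apply: cvgr_dist_le; [exact: cvg_id | exact: divr_gt0].
rewrite ler_pdivlMr // in xy; apply: le_trans xy.
by rewrite ler_wpM2l // lerDl.
Unshelve. all: by end_near. Qed.

Lemma cvg_dotl {u : nat -> H} {q} a :
  u @ \oo --> q -> (fun n => dot (u n) a) @ \oo --> dot q a.
Proof. by move=> uq; exact: cvg_comp uq (dot_continuous a q). Qed.

Lemma cvg_dotr {u : nat -> H} {q} a :
  u @ \oo --> q -> (fun n => dot a (u n)) @ \oo --> dot a q.
Proof. by rewrite dotC; under eq_fun do rewrite dotC; exact: cvg_dotl. Qed.

Lemma cvg_dotxx {u : nat -> H} {q} :
  u @ \oo --> q -> (fun n => dot (u n) (u n)) @ \oo --> dot q q.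
Proof.
move=> uq; rewrite dotxx; under eq_fun do rewrite dotxx expr2.
by rewrite expr2; apply: cvgM; exact: cvg_norm.
Qed.

(** * Convex sets and nearest points *)

(** Convexity, parametrized from [p] so that [s] serves as the step in [lin_coef_ge0]. *)
Definition segment_closed (D : set H) : Prop :=
  forall p q (s : R), D p -> D q -> 0 <= s <= 1 -> D (p + s *: (q - p)).

(** The parallelogram law at midpoints provides the uniform convexity. Since the sets may fail to be
    closed, [u] is returned along with its limit, for the caller to locate [q]. *)
Lemma nested_convex_near (A : nat -> set H) x (L : R) :
  (forall i j, (i <= j)%N -> A j `<=` A i) ->
  (forall k, segment_closed (A k)) ->
  (forall k e, 0 < e -> exists2 p, A k p & dot (x - p) (x - p) <= L + e) ->
  exists u : nat -> H, exists q,
    [/\ forall k, A k (u k), u @ \oo --> q & dot (x - q) (x - q) <= L].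
Proof.
move=> Adec Aseg AL.
have [|k p q Ap Aq|u [uA uL ud]] := @nested_minimizing_sequence R H
    (fun p => dot (x - p) (x - p)) (fun p q => dot (p - q) (p - q) / 4) A 0 L Adec _ AL.
- by move=> *; exact: dotxx_ge0.
- have s01 : 0 <= (2^-1 : R) <= 1 by rewrite invr_ge0 ler0n invf_le1 ?ler1n ?ltr0n.
  exists (p + 2^-1 *: (q - p)); first exact: Aseg.
  by rewrite !dotE (dotC q p) (dotC p x) (dotC q x); lra.
have /cvg_ex[/= q uq] : cvgn u.
  apply: cvgn_sqr_cauchy => e e0; have e40 : 0 < e / 4 by rewrite divr_gt0.
  have [N hN] := ud _ e40; exists N => i j Ni Nj.
  by have := hN i j Ni Nj; rewrite dotxx; lra.
exists u, q; split=> //.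
apply/ler_addgt0Pr => e /uL[N hN].
have xu : (fun k => x - u k) @ \oo --> x - q by apply: cvgB => //; exact: cvg_cst.
apply: (cvgr_to_le (cvg_dotxx xu)).
by exists N.
Qed.

Lemma proj_onto_nearest (D : set H) x :
  closed D -> segment_closed D -> D !=set0 ->
  D (proj_onto D x) /\ forall y, D y -> `|x - proj_onto D x| <= `|x - y|.
Proof.
move=> Dcl Dseg [p0 Dp0].
apply: (xgetPex 0 (P := [set p | D p /\ forall y, D y -> `|x - p| <= `|x - y|])).
pose V := [set dot (x - p) (x - p) | p in D].
have hV : has_inf V.
  split; first by exists (dot (x - p0) (x - p0)), p0.
  by exists 0 => _ [p _ <-]; exact: dotxx_ge0.
(* The nested sets are all [D], and the level is the least squared distance. *)
have [|k e e0|u [q [uD uq qV]]] := @nested_convex_near (fun=> D) x (inf V) _ (fun=> Dseg).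
- by move=> i j _ p.
- by have [_ [p Dp <-] /ltW] := inf_adherent e0 hV; exists p.
exists q; split=> [|y Dy].
  by apply: (closed_cvg D Dcl _ q uq); exact: nearW.
rewrite -ler_sqr ?nnegrE // -!dotxx; apply: le_trans qV _.
by apply: ge_inf; [exact: (proj2 hV) | exists y].
Qed.

(** From [p] towards [y] the squared distance to [x] has initial slope -2<y - p, x - p>, nonnegative
    by minimality. *)
Lemma nearest_obtuse (D : set H) x p :
  segment_closed D -> D p -> (forall y, D y -> `|x - p| <= `|x - y|) ->
  forall y, D y -> dot (y - p) (x - p) <= 0.
Proof.
move=> Dseg Dp pmin y Dy.
suff : 0 <= - 2 * dot (y - p) (x - p) by lra.
apply: (@lin_coef_ge0 R _ (dot (y - p) (y - p))) => s /andP[s0 s1].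
have /pmin : D (p + s *: (y - p)) by apply: Dseg; rewrite // (ltW s0).
rewrite -ler_sqr ?nnegrE // -!dotxx opprD addrA.
by rewrite !dotE (dotC p x) (dotC y x) (dotC y p); lra.
Qed.

(** * Halfspaces and the operator Q *)

Lemma halfspace_closed x y : closed (halfspace dot x y).
Proof.
have -> : halfspace dot x y = (dot^~ (x - y)) @^-1` [set t | t <= dot y (x - y)].
  by apply/seteqP; split=> z; rewrite /halfspace /= dotBl subr_le0.
by apply: closed_comp; [move=> z _; exact: dot_continuous | exact: closed_le].
Qed.

Lemma halfspace_segment x y : segment_closed (halfspace dot x y).
Proof.
move=> p q s; rewrite /halfspace /= !(dotBl, dotDl, dotZl) => hp hq /andP[s0 s1].
nra.
Qed.

(** The point [w] makes the intersection nonempty, so the projection [q] exists. The obtuse angle at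
    [q] then puts [w] in H(x, q), which carries the zeros of M from one iterate to the next. *)
Lemma haugazeau_QP x y z w :
  halfspace dot x y w -> halfspace dot y z w ->
  let q := haugazeau_Q dot x y z in
  [/\ halfspace dot x y q, halfspace dot y z q & halfspace dot x q w].
Proof.
move=> xyw yzw q; pose D := halfspace dot x y `&` halfspace dot y z.
have Dseg : segment_closed D.
  by move=> a b s [a1 a2] [b1 b2] s01; split; exact: halfspace_segment.
have [] : D q /\ forall y, D y -> `|x - q| <= `|x - y|.
  apply: proj_onto_nearest => //; last by exists w.
  by apply: closedI; exact: halfspace_closed.
move=> [q1 q2] qmin; split=> //.
exact: (nearest_obtuse D x q Dseg (conj q1 q2) qmin).
Qed.

Lemma halfspace_pythagoras {x y z} : halfspace dot x y z ->
  dot (z - y) (z - y) + dot (x - y) (x - y) <= dot (x - z) (x - z).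
Proof.
by rewrite /halfspace /= !dotE (dotC z x) (dotC y x) (dotC z y); lra.
Qed.

(** * Maximal monotonicity, Minty's theorem and resolvents *)

(** Otherwise adding (x, u) to the graph would give a strictly larger monotone operator. *)
Lemma maximally_monotone_mem M x u : maximally_monotone dot M ->
  (forall a b, M a b -> 0 <= dot (x - a) (u - b)) -> M x u.
Proof.
move=> [Mmono Mmax] h; apply: contrapT => nM; apply: Mmax.
exists (fun y => M y `|` [set v | y = x /\ v = u]); split.
  move=> y z v w [yv|[-> ->]] [zw|[-> ->]]; first exact: Mmono.
  - by rewrite -(opprB x) -(opprB u) dotNl dotNr opprK; exact: h.
  - exact: h.
  - by rewrite !subrr dot0l.
split=> [[y v]|]; first by left.
by move=> /(_ (x, u)) sub; apply/nM/sub; right.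
Qed.

(* The function [f] below is F(x, u) + (|x|^2 + |u|^2)/2 in epigraph form, with
   F(x, u) = sup_{(a, b) in M} (<x, b> + <a, u> - <a, b>) the Fitzpatrick
   function of M. It is strongly convex, so it has a minimizer (x, u), without
   any weak compactness; the optimality condition tested at the points of the
   graph of M puts (- u, - x) in M, and tested at (- u, - x) itself gives
   x + u = 0. *)
Lemma minty0 M : maximally_monotone dot M -> (exists a, exists b, M a b) ->
  exists a, M a (- a).
Proof.
move=> Mmax [a0 [b0 Mab0]]; have Mmono := proj1 Mmax.
pose f (p : H * H * R) := p.2 + dot p.1.1 p.1.1 / 2 + dot p.1.2 p.1.2 / 2.
(* The midpoint gap of half a squared norm is |p - q|^2 / 8; the coordinate [p.2] enters [f]
   affinely and contributes nothing. *)
pose d (p q : H * H * R) := dot (p.1.1 - q.1.1) (p.1.1 - q.1.1) / 8 +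
  dot (p.1.2 - q.1.2) (p.1.2 - q.1.2) / 8.
pose A : set (H * H * R) := [set p | forall a b, M a b ->
  dot p.1.1 b + dot a p.1.2 - dot a b <= p.2].
have A0 a b : M a b -> A (a, b, dot a b).
  move=> Mab a' b' Mab' /=; have := Mmono _ _ _ _ Mab Mab'.
  by rewrite !dotE; lra.
have Aseg p q (s : R) : A p -> A q -> 0 <= s <= 1 ->
    A (p.1.1 + s *: (q.1.1 - p.1.1), p.1.2 + s *: (q.1.2 - p.1.2),
       p.2 + s * (q.2 - p.2)).
  move=> Ap Aq /andP[s0 s1] a b Mab /=.
  have := Ap a b Mab; have := Aq a b Mab; rewrite !dotE; nra.
(* Fitzpatrick's inequality <x, u> <= F(x, u): if it failed, maximality would put (x, u) in the
   graph, and the constraint at (x, u) would contradict the failure. Hence f >= |x + u|^2 / 2. *)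
have f_ge0 p : A p -> 0 <= f p.
  move=> Ap; have : dot p.1.1 p.1.2 <= p.2.
    rewrite leNgt; apply/negP => lt.
    have /Ap : M p.1.1 p.1.2.
      apply: maximally_monotone_mem => // a b /Ap.
      by rewrite !dotE; lra.
    by lra.
  have := dotxx_ge0 (p.1.1 + p.1.2); rewrite /f !dotE (dotC p.1.2); lra.
pose V := [set f p | p in A].
have hV : has_inf V.
  split; first by exists (f (a0, b0, dot a0 b0)), (a0, b0, dot a0 b0) => //; exact: A0.
  by exists 0 => _ [p /f_ge0 ? <-].
have V_le p : A p -> inf V <= f p.
  by move=> Ap; apply: ge_inf; [exact: (proj2 hV) | exists p].
have [||k e e0|k p q Ap Aq|z [zA zV zd]] :=
  @nested_minimizing_sequence R _ f d (fun=> A) 0 (inf V).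
- by move=> i j _ p.
- by move=> _; exact: f_ge0.
- by have [_ [p Ap <-] /ltW] := inf_adherent e0 hV; exists p.
- have s01 : 0 <= (2^-1 : R) <= 1 by rewrite invr_ge0 ler0n invf_le1 ?ler1n ?ltr0n.
  eexists; first exact: Aseg Ap Aq s01.
  rewrite /f /d /= !dotE (dotC q.1.1 p.1.1) (dotC q.1.2 p.1.2); lra.
have /cvg_ex[/= x zx] : cvgn (fun k => (z k).1.1).
  apply: cvgn_sqr_cauchy => e e0; have e80 : 0 < e / 8 by rewrite divr_gt0.
  have [N hN] := zd _ e80; exists N => i j Ni Nj.
  have := hN i j Ni Nj; have := dotxx_ge0 ((z i).1.2 - (z j).1.2).
  by rewrite -dotxx /d; lra.
have /cvg_ex[/= u zu] : cvgn (fun k => (z k).1.2).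
  apply: cvgn_sqr_cauchy => e e0; have e80 : 0 < e / 8 by rewrite divr_gt0.
  have [N hN] := zd _ e80; exists N => i j Ni Nj.
  have := hN i j Ni Nj; have := dotxx_ge0 ((z i).1.1 - (z j).1.1).
  by rewrite -dotxx /d; lra.
(* [d] gives no control of the last coordinates of [z], so [t] is chosen to make [f] equal to its
   infimum. *)
pose t := inf V - dot x x / 2 - dot u u / 2.
have At : A (x, u, t).
  move=> a b Mab /=.
  suff : dot x b + dot a u - dot a b + (dot x x / 2 + dot u u / 2) <= inf V.
    by rewrite /t; lra.
  apply/ler_addgt0Pr => e /zV[N hN].
  have zcvg : (fun k => dot (z k).1.1 b + dot a (z k).1.2 - dot a b +
      (dot (z k).1.1 (z k).1.1 / 2 + dot (z k).1.2 (z k).1.2 / 2)) @ \oo -->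
      dot x b + dot a u - dot a b + (dot x x / 2 + dot u u / 2).
    apply: cvgD; last first.
      by apply: cvgD; apply: cvgMl; exact: cvg_dotxx.
    apply: cvgB; last exact: cvg_cst.
    by apply: cvgD; [exact: cvg_dotl | exact: cvg_dotr].
  apply: (cvgr_to_le zcvg); exists N => // k /= /hN.
  by have := zA k a b Mab; rewrite /f; lra.
have opt p : A p -> 0 <= p.2 - t + dot x (p.1.1 - x) + dot u (p.1.2 - u).
  move=> Ap.
  apply: (@lin_coef_ge0 R _ ((dot (p.1.1 - x) (p.1.1 - x) +
    dot (p.1.2 - u) (p.1.2 - u)) / 2)) => s /andP[s0 s1].
  have s01 : 0 <= s <= 1 by rewrite (ltW s0).
  have := V_le _ (Aseg _ _ _ At Ap s01).
  by rewrite /f /= !dotE (dotC _ x) (dotC _ u) /t; lra.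
have t_ge : dot x u <= t.
  rewrite leNgt; apply/negP => lt.
  have /At /= : M x u.
    apply: maximally_monotone_mem => // a b /At /=.
    by rewrite !dotE; lra.
  by lra.
(* Optimality at (a, b, <a, b>), with t bounded below by <x, u>. *)
have ge a b : M a b -> dot (x + u) (x + u) <= dot (a + u) (b + x).
  move=> /A0/opt /=; rewrite !dotE (dotC x a) (dotC u x); lra.
have Mux : M (- u) (- x).
  apply: maximally_monotone_mem => // a b /ge.
  by have := dotxx_ge0 (x + u); rewrite !dotE (dotC u x); lra.
exists (- u); rewrite opprK; have := ge _ _ Mux.
rewrite addNr dot0l dotxx => /(conj (sqr_ge0 _))/andP/le_anti/esym/eqP.
by rewrite sqrf_eq0 normr_eq0 addr_eq0 => /eqP xu; rewrite xu opprK in Mux.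
Qed.

(** Translating the values of M by -y preserves maximal monotonicity and reduces to [minty0]. *)
Lemma minty M y : maximally_monotone dot M -> (exists a, exists b, M a b) ->
  exists a, M a (y - a).
Proof.
move=> Mmax [a0 [b0 Mab0]].
have [||a Ma] := @minty0 (fun a b => M a (b + y)); last by exists a; rewrite addrC.
- split=> [a a' b b' Mab Mab'|[N [Nmono [MN NM]]]].
    by have := proj1 Mmax _ _ _ _ Mab Mab'; rewrite opprD addrACA subrr addr0.
  apply: NM => -[a b] Nab; apply: maximally_monotone_mem => // a' b' Mab'.
  have /(Nmono _ _ _ _ Nab) : N a' (b' - y) by apply: (MN (a', b' - y)); rewrite /graph_op /= subrK.
  by rewrite opprB addrA.
- by exists a0, (b0 - y); rewrite subrK.
Qed.

(** Minty's theorem for cM ensures that [xget] selects an actual element rather than the default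
    0. *)
Lemma resolventP M (c : R) x : maximally_monotone dot M -> zer M !=set0 ->
  0 < c -> let j := resolvent (scale_op c M) x in M j (c^-1 *: (x - j)).
Proof.
move=> Mmax [z Mz] c0; have cn0 : c != 0 by rewrite gt_eqF.
have scaled a u : scale_op c M a u -> M a (c^-1 *: u).
  by move=> [v Mv <-]; rewrite scalerA mulVf // scale1r.
have [||j Mj] := @minty (scale_op c M) x.
- split=> [a b _ _ [u Mu <-] [v Mv <-]|[N [Nmono [MN NM]]]].
    by rewrite -scalerBr dotZr pmulr_rge0 //; exact: (proj1 Mmax).
  apply: NM => -[a u] Nau; exists (c^-1 *: u); last by rewrite scalerA mulfV // scale1r.
  apply: maximally_monotone_mem => // b v Mbv.
  have /(Nmono _ _ _ _ Nau) : N b (c *: v) by apply: (MN (b, c *: v)); exists v.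
  have -> : u - c *: v = c *: (c^-1 *: u - v).
    by rewrite scalerBr scalerA mulfV // scale1r.
  by rewrite dotZr pmulr_rge0.
- by exists z, (c *: 0), 0.
have [u Mu /= ux] : inv_op (id_plus_op (scale_op c M)) x (resolvent (scale_op c M) x).
  by apply: xgetPex; exists j, (x - j) => //; rewrite addrC subrK.
by move=> /=; rewrite -[X in X - _]ux addrC addKr; exact: scaled.
Qed.

End Hilbert.

(** * Strong convergence of the iteration *)

Theorem theorem5p3 (R : realType) (H : completeNormedModType R)
    (dot : {dot H for idfun}) (hdot : induces_norm dot)
    (M : H -> set H) (hM : maximally_monotone dot M)
    (hZ : zer M !=set0)
    (x0 : H)
    (lambda : nat -> R) (hlambda : forall n, 0 < lambda n <= 1)
    (hlambda_inf : 0 < inf (range lambda))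
    (gamma : nat -> R) (hgamma : forall n, 0 < gamma n)
    (hgamma_inf : 0 < inf (range gamma))
    (x : nat -> H) (hx0 : x 0%N = x0)
    (hx : forall n : nat,
      x n.+1 =
      haugazeau_Q dot x0 (x n)
        (x n + lambda n *: (resolvent (scale_op (gamma n) M) (x n) - x n))) :
  x @ \oo --> proj_onto (zer M) x0.
Proof.
pose j n := resolvent (scale_op (gamma n) M) (x n).
pose y n := x n + lambda n *: (j n - x n).
have Mj n : M (j n) ((gamma n)^-1 *: (x n - j n)) by exact: resolventP.
(* Monotonicity gives <z - j, x - j> <= 0; replacing j by y adds -(1 - lambda)|j - x|^2, nonpositive
   because lambda <= 1. *)
have Zy n z : zer M z -> halfspace dot (x n) (y n) z.
  move=> Mz; have := proj1 hM _ _ _ _ Mz (Mj n).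
  rewrite sub0r -scalerN dotZr pmulr_rge0 ?invr_gt0 // opprB.
  have -> : z - j n = z - x n - (j n - x n) by rewrite opprB addrA subrK.
  rewrite /halfspace /=.
  have -> : x n - y n = - (lambda n *: (j n - x n)) by rewrite opprD addrA subrr sub0r.
  have -> : z - y n = z - x n - lambda n *: (j n - x n) by rewrite opprD addrA.
  have := dotxx_ge0 hdot (j n - x n); have /andP[l0 l1] := hlambda n.
  move: (j n - x n) (z - x n) => v w.
  rewrite dotNr dotZr !dotBl dotZl => v0 wv; rewrite oppr_le0 mulr_ge0 ?(ltW l0) //.
  by have := ler_piMl v0 l1; lra.
have Zx n z : zer M z -> halfspace dot x0 (x n) z.
  move=> Mz; elim: n => [|n IHn]; first by rewrite /halfspace /= hx0 subrr dot0r.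
  by rewrite hx; have [] := haugazeau_QP hdot _ _ _ _ IHn (Zy n z Mz).
have [z0 Mz0] := hZ.
have xS n : halfspace dot x0 (x n) (x n.+1) /\ halfspace dot (x n) (y n) (x n.+1).
  by rewrite hx; have [] := haugazeau_QP hdot _ _ _ _ (Zx n _ Mz0) (Zy n _ Mz0).
pose r n := dot (x0 - x n) (x0 - x n).
have rP n p : halfspace dot x0 (x n) p ->
    dot (p - x n) (p - x n) <= dot (x0 - p) (x0 - p) - r n.
  by move=> /halfspace_pythagoras; rewrite /r; lra.
have r_le n z : zer M z -> r n <= dot (x0 - z) (x0 - z).
  by move=> /(Zx n)/rP; have := dotxx_ge0 hdot (z - x n); lra.
have rS n : r n <= r n.+1.
  by have [/rP] := xS n; rewrite -/(r _); have := dotxx_ge0 hdot (x n.+1 - x n); lra.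
have r_mono : nondecreasing_seq r by apply/nondecreasing_seqP.
pose L := sup (range r).
have hL : has_sup (range r).
  split; first by exists (r 0%N), 0%N.
  by exists (dot (x0 - z0) (x0 - z0)) => _ [n _ <-]; exact: r_le.
have rL n : r n <= L by apply: sup_upper_bound => //; exists n.
have Lr e : 0 < e -> exists N, forall n, (N <= n)%N -> L - e < r n.
  move=> e0; have [_ [N _ <-] lt] := sup_adherent e0 hL.
  by exists N => n /r_mono; exact: lt_le_trans.
pose l0 := inf (range lambda); pose g0 := inf (range gamma).
have l0_gt0 : 0 < l0 by [].
have l0_le n : l0 <= lambda n.
  by apply: ge_inf; [exists 0 => _ [k _ <-]; have /andP[/ltW] := hlambda k | exists n].
have g0_le n : g0 <= gamma n.
  by apply: ge_inf; [exists 0 => _ [k _ <-]; exact: ltW | exists n].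
pose s n := `|j n - x n|.
have s_ge0 n : 0 <= s n by exact: normr_ge0.
(* Membership of x_{n+1} in H(x_n, y_n) forces a move of length at least |y_n - x_n| = lambda_n
   s_n. *)
have s_le n : (l0 * s n) ^+ 2 <= r n.+1 - r n.
  have [/rP + xy] := xS n; apply: le_trans.
  have : dot (y n - x n) (y n - x n) <= dot (x n.+1 - x n) (x n.+1 - x n).
    have := halfspace_pythagoras xy; have := dotxx_ge0 hdot (x n.+1 - y n).
    by rewrite !(dotxx hdot) (distrC (x n)) (distrC (x n)); lra.
  apply: le_trans; rewrite /y [x n + _]addrC addrK (dotxx hdot) normrZ -/(s n).
  have /andP[/ltW ln0 _] := hlambda n; rewrite (ger0_norm ln0).
  rewrite ler_sqr ?nnegrE ?mulr_ge0 ?s_ge0 ?(ltW l0_gt0) //.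
  exact: ler_wpM2r.
pose Z0 := `|x0 - z0|; have Z0_ge0 : 0 <= Z0 by exact: normr_ge0.
have xZ0 n : `|x0 - x n| <= Z0.
  by rewrite -ler_sqr ?nnegrE // /Z0 -!(dotxx hdot); exact: r_le.
pose B := `|x0| + Z0 + Z0 / l0.
have jB n : `|j n| <= B.
  have sZ : s n <= Z0 / l0.
    rewrite ler_pdivlMr // mulrC -ler_sqr ?nnegrE ?mulr_ge0 ?s_ge0 ?(ltW l0_gt0) //.
    apply: le_trans (s_le n) _; rewrite -(dotxx hdot).
    by have := r_le n.+1 _ Mz0; have := dotxx_ge0 hdot (x0 - x n); rewrite -/(r n); lra.
  have -> : j n = x0 - (x0 - x n) + (j n - x n) by rewrite subKr addrC subrK.
  apply: le_trans (ler_normD _ _) _; apply: lerD => //.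
  by apply: le_trans (ler_normB _ _) _; rewrite lerD.
(* In <a - x_n, b> = <a - j_n, b> + <j_n - x_n, b>, monotonicity bounds the first term below by
   -(|a| + B) s_n / g0, Cauchy-Schwarz the second by -s_n |b|. *)
pose K (a b : H) := `|b| + (`|a| + B) / g0.
have B0 : 0 <= B by apply: le_trans (jB 0%N).
have K0 a b : 0 <= K a b.
  rewrite /K addr_ge0 // divr_ge0 //; last exact: ltW.
  exact: addr_ge0.
have xK n a b : M a b -> - (s n * K a b) <= dot (a - x n) b.
  move=> Mab; set u := (gamma n)^-1 *: (x n - j n).
  have := proj1 hM _ _ _ _ Mab (Mj n); rewrite -/u.
  have -> : a - x n = (a - j n) + (j n - x n) by rewrite addrA subrK.
  rewrite dotBr dotDl.
  have h1 : - (s n * `|b|) <= dot (j n - x n) b.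
    by rewrite lerNl; apply: le_trans (cauchy_schwarz hdot _ _); rewrite -normrN ler_norm.
  have h2 : - (s n * ((`|a| + B) / g0)) <= dot (a - j n) u.
    rewrite lerNl; apply: (@le_trans _ _ (`|a - j n| * `|u|)).
      by apply: le_trans (cauchy_schwarz hdot _ _); rewrite -normrN ler_norm.
    have -> : s n * ((`|a| + B) / g0) = (`|a| + B) * (g0^-1 * s n) by ring.
    apply: ler_pM => //.
      by apply: le_trans (ler_normB _ _) _; rewrite lerD.
    rewrite /u normrZ distrC ler_wpM2r // gtr0_norm ?invr_gt0 //.
    by rewrite lef_pV2 ?posrE.
  by rewrite /K mulrDr; lra.
(* Weighting the tolerance by [K a b] lets one bound s_n <= 1/(k+1) meet all constraints at once. *)
pose A k : set H := [set p | forall a b, M a b -> - (k.+1%:R^-1 * K a b) <= dot (a - p) b].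
have [m n mn p Ap a b Mab|k p q t Ap Aq /andP[t0 t1] a b Mab|k e e0|u [q [uA uq qL]]] :=
  @nested_convex_near R H dot hdot A x0 L.
- apply: le_trans (Ap a b Mab); rewrite lerN2 ler_wpM2r //.
  by rewrite lef_pV2 ?posrE ?ltr0n // ler_nat ltnS.
- have := Ap a b Mab; have := Aq a b Mab.
  by rewrite !dotE; move: (_ * K a b) => c; nra.
- have k0 : 0 < k.+1%:R^-1 :> R by rewrite invr_gt0 ltr0n.
  (* By [s_le], a gap L - r_N below this square yields s_N <= 1/(k+1). *)
  have lk : 0 < (l0 * k.+1%:R^-1) ^+ 2 by rewrite exprn_gt0 // mulr_gt0.
  have [N hN] := Lr _ lk; exists (x N); last by apply: le_trans (rL N) _; rewrite lerDl ltW.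
  move=> a b Mab; apply: le_trans (xK N _ _ Mab); rewrite lerN2 ler_wpM2r //.
  rewrite -(ler_pM2l l0_gt0) -ler_sqr ?nnegrE ?mulr_ge0 ?s_ge0 ?(ltW k0) ?(ltW l0_gt0) //.
  apply: le_trans (s_le N) _.
  by have := hN N (leqnn N); have := rL N.+1; move: (_ ^+ 2) => c; lra.
have Mq : zer M q.
  apply: (maximally_monotone_mem M q 0 hM) => // a b Mab.
  rewrite sub0r dotNr -dotNl opprB.
  have lim : (fun k => dot (a - u k) b + k.+1%:R^-1 * K a b) @ \oo --> dot (a - q) b.
    rewrite -[X in _ --> X]addr0 -[X in _ --> _ + X](mul0r (K a b)).
    apply: cvgD; last by apply: cvgMl; exact: cvg_harmonic.
    by apply: cvg_dotl => //; apply: cvgB => //; exact: cvg_cst.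
  apply: (cvgr_to_ge lim); apply: nearW => k.
  by rewrite -lerBlDr sub0r; exact: uA.
set p := proj_onto (zer M) x0.
(* [q] attains the minimal distance, as |x0 - q|^2 <= L <= |x0 - z|^2 for every zero z; so [xget]
   does not default. *)
have [Mp pmin] : zer M p /\ forall z, zer M z -> `|x0 - p| <= `|x0 - z|.
  apply: (xgetPex 0 (P := [set p | zer M p /\ forall z, zer M z -> `|x0 - p| <= `|x0 - z|])).
  exists q; split=> // z Mz; rewrite -ler_sqr ?nnegrE // -!(dotxx hdot).
  apply: le_trans qL _; apply: ge_sup; first exact: (proj1 hL).
  by move=> _ [n _ <-]; exact: r_le.
have pL : dot (x0 - p) (x0 - p) <= L.
  apply: le_trans qL; rewrite !(dotxx hdot) ler_sqr ?nnegrE //.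
  exact: pmin.
apply/cvgrPdist_le => e e0; have e20 : 0 < e ^+ 2 by rewrite exprn_gt0.
have [N hN] := Lr _ e20; exists N => // n /= /hN lt.
rewrite -ler_sqr ?nnegrE ?(ltW e0) // -(dotxx hdot).
by have := rP n p (Zx n p Mp); lra.
Qed.
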